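(* (Isotopy Invariance.) Let $S$ be a complete semiring, $(\mathbf{C},\otimes,I)$ a small strict monoidal category, and $\mathcal{F}$ a system of fields. Isotopic homeomorphisms $\phi,\psi:M\to N$ of closed $n$-manifolds induce equal isomorphisms $\phi_*=\psi_*:Z(M)\to Z(N)$ on state modules. In particular, the action of the group $\operatorname{Homeo}(M)$ of self-homeomorphisms of $M$ on $Z(M)$ factors through the mapping class group.
   Context: A semiring $(S,+,\cdot,0,1)$ consists of a commutative monoid $(S,+,0)$ and a (not necessarily commutative) monoid $(S,\cdot,1)$ such that $\cdot$ distributes over $+$ from both sides and $0$ is absorbing. A complete monoid is a commutative monoid $(M,+,0)$ with a summation law assigning to every family $(m_i)_{i\in I}$, $I$ an arbitrary set, an element $\sum_{i\in I}m_i$ such that $\sum_{i\in\varnothing}m_i=0$, $\sum_{i\in\{1\}}m_i=m_1$, $\sum_{i\in\{1,2\}}m_i=m_1+m_2$, and $\sum_{j\in J}\big(\sum_{i\in I_j}m_i\big)=\sum_{i\in I}m_i$ for every partition $I=\bigcup_{j\in J}I_j$. A semiring is complete if $(S,+,0,\sum)$ is a complete monoid and $\sum_i ss_i=s\sum_i s_i$, $\sum_i s_is=(\sum_i s_i)s$. $Q=Q_S(\mathbf{C})$ is the set of functions $\operatorname{Mor}(\mathbf{C})\to S$ (with pointwise addition and summation). Fix an integer $n\ge 0$. Manifolds are topological and need not be orientable; $\varnothing$ is a manifold of every dimension; $\sqcup$ is the ordered disjoint union. A bordism from $M$ to $N$ is a triple $(W,M,N)$ (often abbreviated $W$) with $W$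 a compact $(n+1)$-dimensional topological manifold, $\partial W=M\sqcup N$, where the closed $n$-manifolds $M,N$ are the incoming and outgoing boundary. $(W,M,N)\sqcup(W',M',N')=(W\sqcup W',M\sqcup M',N\sqcup N')$. If $W'$ is a bordism from $M$ to $N$ and $W''$ a bordism from $N$ to $P$, gluing along $N$ yields the bordism $W'\cup_N W''$ from $M$ to $P$. A homeomorphism of bordisms is a homeomorphism preserving incoming and outgoing boundaries. $(W_0,M_0,N_0)$ is a subbordism of $(W,M,N)$ if $W_0\subset W$ is a codimension $0$ submanifold, every connected component $C$ of $M_0$ satisfies $C\cap\partial W=\varnothing$ or $C\subset M$, and every connected component $C$ of $N_0$ satisfies $C\cap\partial W=\varnothing$ or $C\subset N$. A system $\mathcal{F}$ of fields assigns to each bordism $W$ a set $\mathcal{F}(W)$ and to each closed $n$-manifold $M$ a set $\mathcal{F}(M)$, with $\mathcal{F}(\varnothing)$ a one-element set, such that: (FRES) There are restriction maps $\mathcal{F}(W)\to\mathcal{F}(W_0)$ for subbordisms $W_0\subset W$, $\mathcal{F}(M)\to\mathcal{F}(M_0)$ for codimension $0$ submanifolds $M_0\subset M$, and $\mathcal{F}(W)\to\mathcal{F}(M)$ for closed codimension $1$ submanifolds $M\subset W$; they are written $f\mapsto f|_{(-)}$ and commute with each other in the obvious way (restricting in stages equals restricting directly). (FHOMEO) A homeomorphism of bordisms $\phi:W\to W'$ induces a bijection $\phi^*:\mathcal{F}(W')\to\mathcal{F}(W)$ with $(\operatorname{id}_W)^*=\operatorname{id}$, $(\psi\circ\phi)^*=\phi^*\circ\psi^*$;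 similarly for homeomorphisms of closed $n$-manifolds; these maps commute with the restriction maps. (FDISJ) The products of restrictions $\mathcal{F}(W\sqcup W')\to\mathcal{F}(W)\times\mathcal{F}(W')$ and $\mathcal{F}(M\sqcup N)\to\mathcal{F}(M)\times\mathcal{F}(N)$ are bijections. (FGLUE) For $W=W'\cup_N W''$, the map $\mathcal{F}(W)\to\mathcal{F}(W')\times_{\mathcal{F}(N)}\mathcal{F}(W'')$ given by the restrictions to $W'$ and $W''$ is a bijection onto the pullback. For a closed $n$-manifold $M$, the state module is the set $Z(M)$ of all functions $z:\mathcal{F}(M)\to Q$ such that $z(\phi^*f)=z(f)$ for all $f\in\mathcal{F}(M)$ and all homeomorphisms $\phi:M\to M$ isotopic to the identity. An isotopy between homeomorphisms $\phi,\psi:M\to N$ is a homotopy $H:M\times[0,1]\to N$ from $\phi$ to $\psi$ through homeomorphisms. A homeomorphism $\phi:M\to N$ of closed $n$-manifolds induces an isomorphism $\phi_*:Z(M)\to Z(N)$, $\phi_*(z)(g)=z(\phi^*g)$ for $g\in\mathcal{F}(N)$, and this is functorial. The mapping class group of $M$ is the group of isotopy classes of self-homeomorphisms of $M$. *)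

(* Defs.v *)
From HB Require Import structures.
From mathcomp Require Import all_boot all_order all_algebra.
From mathcomp Require Import all_classical all_reals all_analysis.
Import numFieldNormedType.Exports.
Set Implicit Arguments.
Unset Strict Implicit.
Unset Printing Implicit Defensive.
Import Order.TTheory GRing.Theory Num.Theory.
Local Open Scope classical_set_scope.
Local Open Scope ring_scope.

(* The sets ∅, {1} and {1,2} are replaced by arbitrary types with zero, one and
   two elements, since Rocq does not identify types that are in bijection.
   As usual, the blocks of a partition may be empty. *)
HB.mixin Record isCompleteMonoid M of GRing.Nmodule M := {
  csum : forall I : Type, (I -> M) -> M;
  csum_empty : forall (I : Type) (m : I -> M), (I -> False) -> csum I m = 0;
  csum_one : forall (I : Type) (m : I -> M) (i : I),
    (forall k, k = i) -> csum I m = m i;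
  csum_two : forall (I : Type) (m : I -> M) (i j : I),
    i <> j -> (forall k, k = i \/ k = j) -> csum I m = m i + m j;
  csum_partition : forall (I J : Type) (P : J -> set I) (m : I -> M),
    \bigcup_j P j = setT -> trivIset setT P ->
    csum J (fun j => csum (P j) (fun i : P j => m (set_val i))) = csum I m
}.

#[short(type="completeMonoidType")]
HB.structure Definition CompleteMonoid :=
  {M of GRing.Nmodule M & isCompleteMonoid M}.

Arguments csum {s I} m.
Arguments csum_empty {s I} m.
Arguments csum_one {s I} m [i].
Arguments csum_two {s I} m [i j].
Arguments csum_partition {s I J} [P] m.

HB.mixin Record isCompleteSemiRing S
    of GRing.PzSemiRing S & CompleteMonoid S := {
  csum_distrr : forall (I : Type) (s : S) (m : I -> S),
    csum (fun i => s * m i) = s * csum m;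
  csum_distrl : forall (I : Type) (s : S) (m : I -> S),
    csum (fun i => m i * s) = csum m * s
}.

(* [pzSemiRingType] does not require 0 != 1 nor commutativity of *. *)
#[short(type="completeSemiRingType")]
HB.structure Definition CompleteSemiRing :=
  {S of GRing.PzSemiRing S & CompleteMonoid S & isCompleteSemiRing S}.

Section FunCompleteMonoid.
Variables (T : Type) (M : completeMonoidType).

Definition fct_csum (I : Type) (m : I -> T -> M) : T -> M :=
  fun t => csum (fun i => m i t).

Lemma fct_csum_empty (I : Type) (m : I -> T -> M) :
  (I -> False) -> fct_csum m = 0.
Proof. by move=> I0; apply/funext => t; exact: csum_empty. Qed.

Lemma fct_csum_one (I : Type) (m : I -> T -> M) (i : I) :
  (forall k, k = i) -> fct_csum m = m i.
Proof.
by move=> Ii; apply/funext => t; exact: (csum_one (fun i => m i t)).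
Qed.

Lemma fct_csum_two (I : Type) (m : I -> T -> M) (i j : I) :
  i <> j -> (forall k, k = i \/ k = j) -> fct_csum m = m i + m j.
Proof.
by move=> ij Iij; apply/funext => t; exact: (csum_two (fun i => m i t)).
Qed.

Lemma fct_csum_partition (I J : Type) (P : J -> set I) (m : I -> T -> M) :
  \bigcup_j P j = setT -> trivIset setT P ->
  fct_csum (fun j => fct_csum (fun i : P j => m (set_val i))) = fct_csum m.
Proof.
by move=> PT tP; apply/funext => t; exact: (csum_partition (fun i => m i t)).
Qed.

HB.instance Definition _ := isCompleteMonoid.Build (T -> M)
  fct_csum_empty fct_csum_one fct_csum_two fct_csum_partition.

End FunCompleteMonoid.

Record cmonIso (A B : completeMonoidType) := CmonIso {
  iso_fun :> A -> B;
  iso_inv : B -> A;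
  iso_funK : cancel iso_fun iso_inv;
  iso_invK : cancel iso_inv iso_fun;
  iso_0 : iso_fun 0 = 0;
  iso_D : forall x y, iso_fun (x + y) = iso_fun x + iso_fun y;
  iso_csum : forall (I : Type) (m : I -> A),
    iso_fun (csum m) = csum (fun i => iso_fun (m i))
}.

Lemma cmonIso_eq (A B : completeMonoidType) (f g : cmonIso A B) :
  f =1 g -> f = g.
Proof.
move=> fg; have {}fg : iso_fun f = iso_fun g by exact/funext.
have : iso_inv f = iso_inv g.
  by apply/funext => y; rewrite -{1}(iso_invK g y) -fg iso_funK.
case: f g fg => f f' p1 p2 p3 p4 p5 [g g' q1 q2 q3 q4 q5] /= fg f'g'.
move: q1 q2 q3 q4 q5; rewrite -{}fg -{}f'g' => q1 q2 q3 q4 q5.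
by congr CmonIso; exact: Prop_irrelevance.
Qed.

Section CmonIsoGroup.

Definition cmonIso_id (A : completeMonoidType) : cmonIso A A.
Proof. by exists id id. Defined.

Definition cmonIso_comp (A B D : completeMonoidType)
  (g : cmonIso B D) (f : cmonIso A B) : cmonIso A D.
Proof.
exists (g \o f) (iso_inv f \o iso_inv g).
- exact: can_comp (iso_funK g) (iso_funK f).
- exact: can_comp (iso_invK f) (iso_invK g).
- by rewrite /= !iso_0.
- by move=> x y; rewrite /= !iso_D.
- by move=> I m; rewrite /= !iso_csum.
Defined.

Definition cmonIso_inv (A B : completeMonoidType) (f : cmonIso A B) :
  cmonIso B A.
Proof.
exists (iso_inv f) f.
- exact: iso_invK.
- exact: iso_funK.
- by apply: (can_inj (iso_funK f)); rewrite iso_invK iso_0.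
- by move=> x y; apply: (can_inj (iso_funK f)); rewrite iso_D !iso_invK.
- move=> I m; apply: (can_inj (iso_funK f)).
  rewrite iso_csum iso_invK; congr csum.
  by apply/funext => i; rewrite iso_invK.
Defined.

Variable A : completeMonoidType.

Definition cmonAut : Type := cmonIso A A.

HB.instance Definition _ := gen_eqMixin cmonAut.
HB.instance Definition _ := gen_choiceMixin cmonAut.

Let mul (g f : cmonAut) : cmonAut := cmonIso_comp g f.

Let mulA : associative mul.
Proof. by move=> *; exact: cmonIso_eq. Qed.
Let mul1 : left_id (cmonIso_id A : cmonAut) mul.
Proof. by move=> *; exact: cmonIso_eq. Qed.
Let mulr1 : right_id (cmonIso_id A : cmonAut) mul.
Proof. by move=> *; exact: cmonIso_eq. Qed.
Let mulV : left_inverse (cmonIso_id A : cmonAut) (@cmonIso_inv A A) mul.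
Proof. by move=> f; apply: cmonIso_eq => x; exact: (@iso_funK _ _ f). Qed.
Let mulrV : right_inverse (cmonIso_id A : cmonAut) (@cmonIso_inv A A) mul.
Proof. by move=> f; apply: cmonIso_eq => x; exact: (@iso_invK _ _ f). Qed.

HB.instance Definition _ :=
  isGroup.Build cmonAut mulA mul1 mulr1 mulV mulrV.

End CmonIsoGroup.

(* One type of all morphisms, so that strictness is plain equality. *)
Record strictMonCat := StrictMonCat {
  ob : Type;
  mor : Type;
  mdom : mor -> ob;
  mcod : mor -> ob;
  mid : ob -> mor;
  mcomp : forall g f : mor, mcod f = mdom g -> mor;
  mdom_id : forall x, mdom (mid x) = x;
  mcod_id : forall x, mcod (mid x) = x;
  mdom_comp : forall g f (e : mcod f = mdom g), mdom (mcomp e) = mdom f;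
  mcod_comp : forall g f (e : mcod f = mdom g), mcod (mcomp e) = mcod g;
  mcomp_idr : forall f (e : mcod (mid (mdom f)) = mdom f), mcomp e = f;
  mcomp_idl : forall f (e : mcod f = mdom (mid (mcod f))), mcomp e = f;
  mcompA : forall h g f (gf : mcod f = mdom g) (hg : mcod g = mdom h)
    (h_gf : mcod (mcomp gf) = mdom h) (hg_f : mcod f = mdom (mcomp hg)),
    mcomp h_gf = mcomp hg_f;
  otens : ob -> ob -> ob;
  mtens : mor -> mor -> mor;
  ounit : ob;
  mdom_tens : forall f g, mdom (mtens f g) = otens (mdom f) (mdom g);
  mcod_tens : forall f g, mcod (mtens f g) = otens (mcod f) (mcod g);
  mtens_id : forall x y, mtens (mid x) (mid y) = mid (otens x y);
  mtens_comp : forall g f g' f' (e : mcod f = mdom g) (e' : mcod f' = mdom g')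
    (ee' : mcod (mtens f f') = mdom (mtens g g')),
    mtens (mcomp e) (mcomp e') = mcomp ee';
  otensA : associative otens;
  otens1x : left_id ounit otens;
  otensx1 : right_id ounit otens;
  mtensA : associative mtens;
  mtens1x : left_id (mid ounit) mtens;
  mtensx1 : right_id (mid ounit) mtens
}.

Definition Qset (S : completeSemiRingType) (C : strictMonCat) : Type :=
  mor C -> S.
HB.instance Definition _ S C :=
  CompleteMonoid.copy (Qset S C) (mor C -> (S : completeMonoidType)).

Record homeo (X Y : topologicalType) := Homeo {
  homeo_fun :> X -> Y;
  homeo_inv : Y -> X;
  homeo_funK : cancel homeo_fun homeo_inv;
  homeo_invK : cancel homeo_inv homeo_fun;
  homeo_cont : continuous homeo_fun;
  homeo_inv_cont : continuous homeo_inv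
}.

Lemma homeo_eq (X Y : topologicalType) (f g : homeo X Y) : f =1 g -> f = g.
Proof.
move=> fg; have {}fg : homeo_fun f = homeo_fun g by exact/funext.
have : homeo_inv f = homeo_inv g.
  by apply/funext => y; rewrite -{1}(homeo_invK g y) -fg homeo_funK.
case: f g fg => f f' p1 p2 p3 p4 [g g' q1 q2 q3 q4] /= fg f'g'.
move: q1 q2 q3 q4; rewrite -{}fg -{}f'g' => q1 q2 q3 q4.
by congr Homeo; exact: Prop_irrelevance.
Qed.

Definition homeo_id (X : topologicalType) : homeo X X.
Proof. by exists id id => // x; exact: cvg_id. Defined.

Definition homeo_comp (X Y Z : topologicalType)
  (g : homeo Y Z) (f : homeo X Y) : homeo X Z.
Proof.
exists (g \o f) (homeo_inv f \o homeo_inv g).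
- exact: can_comp (homeo_funK g) (homeo_funK f).
- exact: can_comp (homeo_invK f) (homeo_invK g).
- by move=> x; apply: continuous_comp; exact: homeo_cont.
- by move=> x; apply: continuous_comp; exact: homeo_inv_cont.
Defined.

Definition homeo_sym (X Y : topologicalType) (f : homeo X Y) : homeo Y X :=
  Homeo (homeo_invK f) (homeo_funK f) (@homeo_inv_cont _ _ f)
    (@homeo_cont _ _ f).

Definition subsp (T : topologicalType) (A : set T) : topologicalType :=
  set_type A.

Section Isotopy.
Variable R : realType.

Definition unitI : topologicalType := subsp (`[0, 1]%classic : set R).

Definition isotopic (X Y : topologicalType) (phi psi : homeo X Y) : Prop :=
  exists H : X * unitI -> Y,
    [/\ continuous H,
        forall (x : X) (t : unitI), set_val t = 0 -> H (x, t) = phi x,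
        forall (x : X) (t : unitI), set_val t = 1 -> H (x, t) = psi x &
        forall t : unitI, exists h : homeo X Y, forall x, H (x, t) = h x].

Lemma isotopic_refl (X Y : topologicalType) (f : homeo X Y) : isotopic f f.
Proof.
exists (f \o fst); split => //; last by move=> t; exists f.
by move=> p; apply: continuous_comp; [exact: cvg_fst | exact: homeo_cont].
Qed.

Lemma continuous_pair (X Y Z : topologicalType) (f : X -> Y) (g : X -> Z) :
  continuous f -> continuous g -> continuous (fun x => (f x, g x)).
Proof.
move=> cf cg x; apply: (@cvg_pair _ _ _ (nbhs x) (nbhs (f x)) (nbhs (g x))).
- exact: cf.
- exact: cg.
Qed.

Lemma isotopic_comp (X Y Z : topologicalType) (g g' : homeo Y Z)
    (f f' : homeo X Y) :
  isotopic g g' -> isotopic f f' -> isotopic (homeo_comp g f) (homeo_comp g' f').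
Proof.
move=> [G [cG G0 G1 Gh]] [F [cF F0 F1 Fh]].
exists (fun p => G (F p, p.2)); split.
- move=> p; apply: (@continuous_comp _ _ _ (fun p => (F p, p.2)) G).
    by apply: continuous_pair => // q; exact: cvg_snd.
  exact: cG.
- by move=> x t t0; rewrite /= F0 // G0.
- by move=> x t t1; rewrite /= F1 // G1.
- move=> t; have [h hE] := Gh t; have [k kE] := Fh t.
  by exists (homeo_comp h k) => x; rewrite /= kE hE.
Qed.

Lemma rev_unitI_subproof (t : unitI) : 1 - set_val t \in (`[0, 1]%classic : set R).
Proof.
have := set_valP t; rewrite /= in_itv /= => /andP[t0 t1].
by apply/mem_set; rewrite /= in_itv /= subr_ge0 t1 lerBlDr lerDl t0.
Qed.

Definition rev_unitI (t : unitI) : unitI :=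
  exist (fun x => x \in (`[0, 1]%classic : set R)) (1 - set_val t)
    (rev_unitI_subproof t).

Lemma rev_unitIE (t : unitI) : set_val (rev_unitI t) = 1 - set_val t.
Proof. by rewrite [in LHS]set_valE. Qed.

Lemma rev_unitI_cont : continuous rev_unitI.
Proof.
apply: (@continuous_comp_initial _ _ _ (set_val : unitI -> R)).
have -> : (set_val : unitI -> R) \o rev_unitI = fun t => 1 - set_val t.
  by apply/funext => t; exact: rev_unitIE.
move=> t; apply: (@cvgB _ R^o _ (nbhs t)); first exact: cvg_cst.
exact: (@initial_continuous _ _ (set_val : unitI -> R)).
Qed.

Lemma isotopic_sym (X Y : topologicalType) (f g : homeo X Y) :
  isotopic f g -> isotopic g f.
Proof.
move=> [H [cH H0 H1 Hh]]; exists (fun p => H (p.1, rev_unitI p.2)); split.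
- move=> p; apply: (@continuous_comp _ _ _ (fun p => (p.1, rev_unitI p.2)) H).
    apply: (@continuous_pair _ _ _ fst (rev_unitI \o snd)) => q.
      exact: cvg_fst.
    by apply: continuous_comp; [exact: cvg_snd | exact: rev_unitI_cont].
  exact: cH.
- by move=> x t t0; apply: H1; rewrite rev_unitIE t0 subr0.
- by move=> x t t1; apply: H0; rewrite rev_unitIE t1 subrr.
- by move=> t; have [h hE] := Hh (rev_unitI t); exists h.
Qed.

Lemma isotopic_trans (X Y : topologicalType) (g f h : homeo X Y) :
  isotopic f g -> isotopic g h -> isotopic f h.
Proof.
move=> fg gh.
have := isotopic_comp fg (isotopic_comp (isotopic_refl (homeo_sym g)) gh).
congr isotopic; apply: homeo_eq => x /=; first by rewrite homeo_funK.
by rewrite homeo_invK.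
Qed.

Lemma isotopic_homeo_sym (X Y : topologicalType) (f g : homeo X Y) :
  isotopic f g -> isotopic (homeo_sym f) (homeo_sym g).
Proof.
move=> /isotopic_sym gf.
have := isotopic_comp (isotopic_refl (homeo_sym f))
  (isotopic_comp gf (isotopic_refl (homeo_sym g))).
congr isotopic; apply: homeo_eq => x /=; first by rewrite homeo_invK.
by rewrite homeo_funK.
Qed.

End Isotopy.

Section HomeoGroup.
Variable X : topologicalType.

Definition Homeog : Type := homeo X X.

HB.instance Definition _ := gen_eqMixin Homeog.
HB.instance Definition _ := gen_choiceMixin Homeog.

Let mul (g f : Homeog) : Homeog := homeo_comp g f.

Let mulA : associative mul.
Proof. by move=> *; exact: homeo_eq. Qed.
Let mul1 : left_id (homeo_id X : Homeog) mul.
Proof. by move=> *; exact: homeo_eq. Qed.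
Let mulr1 : right_id (homeo_id X : Homeog) mul.
Proof. by move=> *; exact: homeo_eq. Qed.
Let mulV : left_inverse (homeo_id X : Homeog) (@homeo_sym X X) mul.
Proof. by move=> f; apply: homeo_eq => x; exact: (@homeo_funK _ _ f). Qed.
Let mulrV : right_inverse (homeo_id X : Homeog) (@homeo_sym X X) mul.
Proof. by move=> f; apply: homeo_eq => x; exact: (@homeo_invK _ _ f). Qed.

HB.instance Definition _ :=
  isGroup.Build Homeog mulA mul1 mulr1 mulV mulrV.

End HomeoGroup.

Section MappingClassGroup.
Local Open Scope quotient_scope.
Variables (R : realType) (X : topologicalType).

Definition isotopicb : rel (Homeog X) := fun f g => `[< isotopic R f g >].

Lemma isotopicb_refl : reflexive isotopicb.
Proof. by move=> f; apply/asboolP; exact: isotopic_refl. Qed.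

Lemma isotopicb_sym : symmetric isotopicb.
Proof.
by move=> f g; apply/asboolP/asboolP => /isotopic_sym.
Qed.

Lemma isotopicb_trans : transitive isotopicb.
Proof.
move=> g f h /asboolP fg /asboolP gh; apply/asboolP.
exact: isotopic_trans fg gh.
Qed.

Canonical isotopicb_equiv :=
  EquivRel isotopicb isotopicb_refl isotopicb_sym isotopicb_trans.

Definition MCG : Type := {eq_quot isotopicb}.

HB.instance Definition _ := Choice.on MCG.

Definition mcg_class (f : Homeog X) : MCG := \pi_({eq_quot isotopicb}) f.

Lemma mcg_classP (f g : Homeog X) :
  mcg_class f = mcg_class g <-> isotopic R f g.
Proof.
split=> [/eqP|fg]; first by rewrite /mcg_class eqmodE => /asboolP.
by apply/eqP; rewrite /mcg_class eqmodE; exact/asboolP.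
Qed.

Definition mcg_repr (a : MCG) : Homeog X := repr (a : {eq_quot isotopicb}).

Lemma mcg_reprK : cancel mcg_repr mcg_class.
Proof. exact: reprK. Qed.

Definition mcg_one : MCG := mcg_class 1%g.
Definition mcg_mul (a b : MCG) : MCG :=
  mcg_class (mcg_repr a * mcg_repr b)%g.
Definition mcg_inv (a : MCG) : MCG := mcg_class ((mcg_repr a)^-1)%g.

Lemma mcg_classM (f g : Homeog X) :
  mcg_mul (mcg_class f) (mcg_class g) = mcg_class (f * g)%g.
Proof.
by apply/mcg_classP; apply: isotopic_comp; apply/mcg_classP; rewrite mcg_reprK.
Qed.

Lemma mcg_classV (f : Homeog X) : mcg_inv (mcg_class f) = mcg_class (f^-1)%g.
Proof.
by apply/mcg_classP; apply: isotopic_homeo_sym; apply/mcg_classP; rewrite mcg_reprK.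
Qed.

Let mulA : associative mcg_mul.
Proof.
move=> a b c; rewrite -(mcg_reprK a) -(mcg_reprK b) -(mcg_reprK c).
by rewrite !mcg_classM mulgA.
Qed.
Let mul1 : left_id mcg_one mcg_mul.
Proof. by move=> a; rewrite -(mcg_reprK a) mcg_classM mul1g. Qed.
Let mulr1 : right_id mcg_one mcg_mul.
Proof. by move=> a; rewrite -(mcg_reprK a) mcg_classM mulg1. Qed.
Let mulV : left_inverse mcg_one mcg_inv mcg_mul.
Proof. by move=> a; rewrite -(mcg_reprK a) mcg_classV mcg_classM mulVg. Qed.
Let mulrV : right_inverse mcg_one mcg_inv mcg_mul.
Proof. by move=> a; rewrite -(mcg_reprK a) mcg_classV mcg_classM mulgV. Qed.

HB.instance Definition _ := isGroup.Build MCG mulA mul1 mulr1 mulV mulrV.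

End MappingClassGroup.

(* Manifolds are subsets of an ambient space [T] with the subspace topology, so
   that "M0 ⊂ M", "∂W = M ⊔ N" and "W = W' ∪_N W''" are literal relations
   between sets.  An abstract manifold is the case A = setT. *)

Section Manifolds.
Variable R : realType.

(* The points of X with a neighbourhood homeomorphic to an open set of R^d. *)
Definition mfd_interior (d : nat) (X : topologicalType) : set X :=
  [set x | exists (U : set X) (O : set 'rV[R]_d),
    [/\ open U, U x, open O & inhabited (homeo (subsp U) (subsp O))]].

Definition mfd_boundary (d : nat) (X : topologicalType) : set X :=
  ~` mfd_interior d (X := X).

Definition halfspace (d : nat) : set 'rV[R]_d.+1 :=
  [set v | 0 <= v ord0 ord0].

Definition closed_manifold (d : nat) (X : topologicalType) : Prop :=
  [/\ hausdorff_space X, second_countable (T := X), compact [set: X] &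
      mfd_interior d (X := X) = setT].

Definition compact_manifold (d : nat) (X : topologicalType) : Prop :=
  [/\ hausdorff_space X, second_countable (T := X), compact [set: X] &
      forall x : X, exists (U : set X) (O : set 'rV[R]_d.+1),
        [/\ open U, U x, open O &
            inhabited (homeo (subsp U) (subsp (O `&` @halfspace d)))]].

Definition bdry (d : nat) (T : topologicalType) (A : set T) : set T :=
  set_val @` mfd_boundary d (X := subsp A).

Variable n : nat.

Record cmfd (T : topologicalType) := CMfd {
  cm_set : set T;
  cm_manifold : closed_manifold n (subsp cm_set)
}.

Definition cm_space (T : topologicalType) (M : cmfd T) : topologicalType :=
  subsp (cm_set M).

Record bord (T : topologicalType) := Bord {
  b_set : set T;
  b_in : cmfd T;
  b_out : cmfd T;
  b_manifold : compact_manifold n (subsp b_set);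
  b_disj : cm_set b_in `&` cm_set b_out = set0;
  b_bdry : bdry n.+1 b_set = cm_set b_in `|` cm_set b_out
}.

Definition b_space (T : topologicalType) (W : bord T) : topologicalType :=
  subsp (b_set W).

Definition subbord (T : topologicalType) (W0 W : bord T) : Prop :=
  [/\ b_set W0 `<=` b_set W,
      forall x, cm_set (b_in W0) x ->
        let C := connected_component (cm_set (b_in W0)) x in
        C `&` bdry n.+1 (b_set W) = set0 \/ C `<=` cm_set (b_in W) &
      forall x, cm_set (b_out W0) x ->
        let C := connected_component (cm_set (b_out W0)) x in
        C `&` bdry n.+1 (b_set W) = set0 \/ C `<=` cm_set (b_out W)].

Record bhomeo (T T' : topologicalType) (W : bord T) (W' : bord T') := BHomeo {
  bh_homeo :> homeo (b_space W) (b_space W');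
  bh_in : forall x : b_space W,
    cm_set (b_in W) (set_val x) <-> cm_set (b_in W') (set_val (bh_homeo x));
  bh_out : forall x : b_space W,
    cm_set (b_out W) (set_val x) <-> cm_set (b_out W') (set_val (bh_homeo x))
}.

Definition bhomeo_id (T : topologicalType) (W : bord T) : bhomeo W W.
Proof. by exists (homeo_id _). Defined.

Definition bhomeo_comp (T T' T'' : topologicalType) (W : bord T)
  (W' : bord T') (W'' : bord T'') (g : bhomeo W' W'') (f : bhomeo W W') :
  bhomeo W W''.
Proof.
exists (homeo_comp g f) => x.
  exact: iff_trans (bh_in f x) (bh_in g (f x)).
exact: iff_trans (bh_out f x) (bh_out g (f x)).
Defined.

(* f0 : A0 -> B0 is the restriction of f : A -> B. *)
Definition homeo_restr (T T' : topologicalType) (A A0 : set T) (B B0 : set T')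
    (f : homeo (subsp A) (subsp B)) (f0 : homeo (subsp A0) (subsp B0)) : Prop :=
  forall (x : subsp A) (x0 : subsp A0),
    set_val x = set_val x0 -> set_val (f x) = set_val (f0 x0).

(* The next two say that the subspace M of T is M1 ⊔ M2 (resp. that W is
   W1 ⊔ W2): the pieces are compact in a Hausdorff space, so being disjoint
   they are clopen in the union.  The disjoint union of manifolds with
   different or overlapping carriers is formed on copies of them. *)
Definition disj_cmfd (T : topologicalType) (M M1 M2 : cmfd T) : Prop :=
  cm_set M1 `&` cm_set M2 = set0 /\ cm_set M = cm_set M1 `|` cm_set M2.

Definition disj_bord (T : topologicalType) (W W1 W2 : bord T) : Prop :=
  [/\ b_set W1 `&` b_set W2 = set0,
      b_set W = b_set W1 `|` b_set W2,
      disj_cmfd (b_in W) (b_in W1) (b_in W2) &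
      disj_cmfd (b_out W) (b_out W1) (b_out W2)].

(* W is W' ∪_N W'' with N the outgoing boundary of W' and the incoming
   boundary of W''.  As W' and W'' are closed in W, the subspace topology on
   their union is the glued one. *)
Definition glue_bord (T : topologicalType) (W W' W'' : bord T) : Prop :=
  [/\ b_out W' = b_in W'',
      b_set W' `&` b_set W'' = cm_set (b_out W'),
      b_set W = b_set W' `|` b_set W'',
      b_in W = b_in W' &
      b_out W = b_out W''].

Lemma bord_in_sub (T : topologicalType) (W : bord T) :
  cm_set (b_in W) `<=` b_set W.
Proof.
move=> x Mx; have : bdry n.+1 (b_set W) x by rewrite b_bdry; left.
by move=> [y _ <-]; exact: set_valP.
Qed.

Lemma bord_out_sub (T : topologicalType) (W : bord T) :
  cm_set (b_out W) `<=` b_set W.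
Proof.
move=> x Mx; have : bdry n.+1 (b_set W) x by rewrite b_bdry; right.
by move=> [y _ <-]; exact: set_valP.
Qed.

Section Sub.
Variable T : topologicalType.

Lemma disj_cmfd_subl (M M1 M2 : cmfd T) :
  disj_cmfd M M1 M2 -> cm_set M1 `<=` cm_set M.
Proof. by move=> [_ ->] x; left. Qed.

Lemma disj_cmfd_subr (M M1 M2 : cmfd T) :
  disj_cmfd M M1 M2 -> cm_set M2 `<=` cm_set M.
Proof. by move=> [_ ->] x; right. Qed.

Lemma disj_bord_subl (W W1 W2 : bord T) : disj_bord W W1 W2 -> subbord W1 W.
Proof.
move=> [_ WE /disj_cmfd_subl i /disj_cmfd_subl o]; split.
- by rewrite WE => x; left.
- by move=> x _ C; right; apply: subset_trans i; exact: connected_component_sub.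
- by move=> x _ C; right; apply: subset_trans o; exact: connected_component_sub.
Qed.

Lemma disj_bord_subr (W W1 W2 : bord T) : disj_bord W W1 W2 -> subbord W2 W.
Proof.
move=> [_ WE /disj_cmfd_subr i /disj_cmfd_subr o]; split.
- by rewrite WE => x; right.
- by move=> x _ C; right; apply: subset_trans i; exact: connected_component_sub.
- by move=> x _ C; right; apply: subset_trans o; exact: connected_component_sub.
Qed.

Lemma glue_bord_mid (W W' W'' : bord T) : glue_bord W W' W'' ->
  cm_set (b_out W') `&` bdry n.+1 (b_set W) = set0.
Proof.
move=> [e _ _ iW oW]; rewrite b_bdry iW oW -subset0 => x [Nx [Mx|Px]].
  by rewrite -(b_disj W').
by rewrite -(b_disj W''); split => //; rewrite -e.
Qed.

Lemma glue_bord_subl (W W' W'' : bord T) : glue_bord W W' W'' -> subbord W' W.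
Proof.
move=> g; have mid := glue_bord_mid g; case: g => _ _ WE iW _; split.
- by rewrite WE => x; left.
- by move=> x _ C; right; rewrite iW; exact: connected_component_sub.
- move=> x _ C; left; rewrite -subset0 -mid => y [Cy by_]; split => //.
  exact: connected_component_sub Cy.
Qed.

Lemma glue_bord_subr (W W' W'' : bord T) : glue_bord W W' W'' -> subbord W'' W.
Proof.
move=> g; have mid := glue_bord_mid g; case: g => e _ WE _ oW; split.
- by rewrite WE => x; right.
- move=> x _ C; left; rewrite -subset0 -mid => y [Cy by_]; split => //.
  by rewrite e; exact: connected_component_sub Cy.
- by move=> x _ C; right; rewrite oW; exact: connected_component_sub.
Qed.

Lemma glue_bord_mid_sub (W W' W'' : bord T) : glue_bord W W' W'' ->
  cm_set (b_out W') `<=` b_set W''.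
Proof. by move=> [-> _ _ _ _]; exact: bord_in_sub. Qed.

End Sub.

(* f|_W = f and f|_M = f are not imposed: they follow from [fB_disj], [fM_disj]
   and the stage laws by splitting off the empty manifold. *)
Record fieldSystem := FieldSystem {
  fB : forall T : topologicalType, bord T -> Type;
  fM : forall T : topologicalType, cmfd T -> Type;
  fB_empty : forall (T : topologicalType) (W : bord T), b_set W = set0 ->
    exists f : fB W, forall g, g = f;
  fM_empty : forall (T : topologicalType) (M : cmfd T), cm_set M = set0 ->
    exists f : fM M, forall g, g = f;

  resBB : forall (T : topologicalType) (W0 W : bord T),
    subbord W0 W -> fB W -> fB W0;
  resMM : forall (T : topologicalType) (M0 M : cmfd T),
    cm_set M0 `<=` cm_set M -> fM M -> fM M0;
  resBM : forall (T : topologicalType) (W : bord T) (M : cmfd T),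
    cm_set M `<=` b_set W -> fB W -> fM M;
  resBB_BB : forall (T : topologicalType) (W1 W0 W : bord T)
    (s10 : subbord W1 W0) (s0 : subbord W0 W) (s1 : subbord W1 W) (f : fB W),
    resBB s10 (resBB s0 f) = resBB s1 f;
  resMM_MM : forall (T : topologicalType) (M1 M0 M : cmfd T)
    (s10 : cm_set M1 `<=` cm_set M0) (s0 : cm_set M0 `<=` cm_set M)
    (s1 : cm_set M1 `<=` cm_set M) (f : fM M),
    resMM s10 (resMM s0 f) = resMM s1 f;
  resBM_BB : forall (T : topologicalType) (W0 W : bord T) (M : cmfd T)
    (sM0 : cm_set M `<=` b_set W0) (s0 : subbord W0 W)
    (sM : cm_set M `<=` b_set W) (f : fB W),
    resBM sM0 (resBB s0 f) = resBM sM f;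
  resMM_BM : forall (T : topologicalType) (W : bord T) (M0 M : cmfd T)
    (s0 : cm_set M0 `<=` cm_set M) (sM : cm_set M `<=` b_set W)
    (sM0 : cm_set M0 `<=` b_set W) (f : fB W),
    resMM s0 (resBM sM f) = resBM sM0 f;

  pullB : forall (T T' : topologicalType) (W : bord T) (W' : bord T'),
    bhomeo W W' -> fB W' -> fB W;
  pullM : forall (T T' : topologicalType) (M : cmfd T) (N : cmfd T'),
    homeo (cm_space M) (cm_space N) -> fM N -> fM M;
  pullB_bij : forall (T T' : topologicalType) (W : bord T) (W' : bord T')
    (phi : bhomeo W W'), bijective (pullB phi);
  pullM_bij : forall (T T' : topologicalType) (M : cmfd T) (N : cmfd T')
    (phi : homeo (cm_space M) (cm_space N)), bijective (pullM phi);
  pullB_id : forall (T : topologicalType) (W : bord T) (f : fB W),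
    pullB (bhomeo_id W) f = f;
  pullM_id : forall (T : topologicalType) (M : cmfd T) (f : fM M),
    pullM (homeo_id (cm_space M)) f = f;
  pullB_comp : forall (T T' T'' : topologicalType)
    (W : bord T) (W' : bord T') (W'' : bord T'')
    (psi : bhomeo W' W'') (phi : bhomeo W W') (f : fB W''),
    pullB (bhomeo_comp psi phi) f = pullB phi (pullB psi f);
  pullM_comp : forall (T T' T'' : topologicalType)
    (M : cmfd T) (M' : cmfd T') (M'' : cmfd T'')
    (psi : homeo (cm_space M') (cm_space M''))
    (phi : homeo (cm_space M) (cm_space M')) (f : fM M''),
    pullM (homeo_comp psi phi) f = pullM phi (pullM psi f);
  pullB_resBB : forall (T T' : topologicalType)
    (W0 W : bord T) (W0' W' : bord T')
    (s : subbord W0 W) (s' : subbord W0' W')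
    (phi : bhomeo W W') (phi0 : bhomeo W0 W0') (f : fB W'),
    homeo_restr phi phi0 ->
    resBB s (pullB phi f) = pullB phi0 (resBB s' f);
  pullB_resBM : forall (T T' : topologicalType)
    (W : bord T) (M : cmfd T) (W' : bord T') (M' : cmfd T')
    (s : cm_set M `<=` b_set W) (s' : cm_set M' `<=` b_set W')
    (phi : bhomeo W W') (phi0 : homeo (cm_space M) (cm_space M')) (f : fB W'),
    homeo_restr phi phi0 ->
    resBM s (pullB phi f) = pullM phi0 (resBM s' f);
  pullM_resMM : forall (T T' : topologicalType)
    (M0 M : cmfd T) (M0' M' : cmfd T')
    (s : cm_set M0 `<=` cm_set M) (s' : cm_set M0' `<=` cm_set M')
    (phi : homeo (cm_space M) (cm_space M'))
    (phi0 : homeo (cm_space M0) (cm_space M0')) (f : fM M'),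
    homeo_restr phi phi0 ->
    resMM s (pullM phi f) = pullM phi0 (resMM s' f);

  fB_disj : forall (T : topologicalType) (W W1 W2 : bord T)
    (d : disj_bord W W1 W2),
    bijective (fun f : fB W =>
      (resBB (disj_bord_subl d) f, resBB (disj_bord_subr d) f));
  fM_disj : forall (T : topologicalType) (M M1 M2 : cmfd T)
    (d : disj_cmfd M M1 M2),
    bijective (fun f : fM M =>
      (resMM (disj_cmfd_subl d) f, resMM (disj_cmfd_subr d) f));

  (* The pullback consists of the pairs that agree on N; the map lands
     in it by [resBM_BB]. *)
  fB_glue : forall (T : topologicalType) (W W' W'' : bord T)
    (g : glue_bord W W' W'') (f' : fB W') (f'' : fB W''),
    resBM (bord_out_sub (W := W')) f' = resBM (glue_bord_mid_sub g) f'' ->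
    exists! f : fB W,
      resBB (glue_bord_subl g) f = f' /\ resBB (glue_bord_subr g) f = f''
}.

End Manifolds.

Section StateModule.
Variables (R : realType) (n : nat) (S : completeSemiRingType)
  (C : strictMonCat) (F : fieldSystem R n).

Record state (T : topologicalType) (M : cmfd R n T) := State {
  state_fun :> fM F M -> Qset S C;
  stateP : forall (f : fM F M) (phi : homeo (cm_space M) (cm_space M)),
    isotopic R phi (homeo_id _) -> state_fun (pullM phi f) = state_fun f
}.

Section StateMonoid.
Variables (T : topologicalType) (M : cmfd R n T).

Lemma state_eq (z w : state M) : z =1 w -> z = w.
Proof.
case: z w => z zP [w wP] /= zw; have {}zw : z = w by exact/funext.
by move: wP; rewrite -zw => wP; congr State; exact: Prop_irrelevance.
Qed.

HB.instance Definition _ := gen_eqMixin (state M).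
HB.instance Definition _ := gen_choiceMixin (state M).

Definition state_zero : state M.
Proof. by exists 0. Defined.

Definition state_add (z w : state M) : state M.
Proof.
by exists ((z : fM F M -> Qset S C) + w) => f phi iso; rewrite /GRing.add /= !stateP.
Defined.

Definition state_csum (I : Type) (z : I -> state M) : state M.
Proof.
exists (csum (fun i => z i : fM F M -> Qset S C)) => f phi iso.
by congr csum; apply/funext => i; rewrite stateP.
Defined.

Let addA : associative state_add.
Proof. by move=> x y z; apply: state_eq => f; exact: addrA. Qed.
Let addC : commutative state_add.
Proof. by move=> x y; apply: state_eq => f; exact: addrC. Qed.
Let add0 : left_id state_zero state_add.
Proof. by move=> x; apply: state_eq => f; exact: add0r. Qed.

HB.instance Definition _ := GRing.isNmodule.Build (state M) addA addC add0.

Let csum0 (I : Type) (m : I -> state M) :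
  (I -> False) -> state_csum m = 0.
Proof. by move=> I0; apply: state_eq => f; exact: csum_empty. Qed.
Let csum1 (I : Type) (m : I -> state M) (i : I) :
  (forall k, k = i) -> state_csum m = m i.
Proof.
move=> Ii; apply: state_eq => f; exact: (csum_one (fun i => m i f)).
Qed.
Let csum2 (I : Type) (m : I -> state M) (i j : I) :
  i <> j -> (forall k, k = i \/ k = j) -> state_csum m = m i + m j.
Proof.
move=> ij Iij; apply: state_eq => f; exact: (csum_two (fun i => m i f)).
Qed.
Let csumP (I J : Type) (P : J -> set I) (m : I -> state M) :
  \bigcup_j P j = setT -> trivIset setT P ->
  state_csum (fun j => state_csum (fun i : P j => m (set_val i))) =
  state_csum m.
Proof.
move=> PT tP; apply: state_eq => f.
exact: (csum_partition (fun i => m i f)).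
Qed.

HB.instance Definition _ :=
  isCompleteMonoid.Build (state M) csum0 csum1 csum2 csumP.

End StateMonoid.

Section Push.
Variables (T T' : topologicalType) (M : cmfd R n T) (N : cmfd R n T').

Definition push_fun (phi : homeo (cm_space M) (cm_space N)) (z : state M) :
  state N.
Proof.
exists (fun g => z (pullM phi g)) => g chi chi1; rewrite -pullM_comp.
pose chi' := homeo_comp (homeo_sym phi) (homeo_comp chi phi).
have -> : homeo_comp chi phi = homeo_comp phi chi'.
  by apply: homeo_eq => x /=; rewrite homeo_invK.
rewrite pullM_comp stateP //.
have -> : homeo_id (cm_space M) =
    homeo_comp (homeo_sym phi) (homeo_comp (homeo_id _) phi).
  by apply: homeo_eq => x /=; rewrite homeo_funK.
apply: isotopic_comp; first exact: isotopic_refl.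
by apply: isotopic_comp => //; exact: isotopic_refl.
Defined.

End Push.

(* The isomorphism phi_* of state modules. *)
Definition push (T T' : topologicalType) (M : cmfd R n T) (N : cmfd R n T')
  (phi : homeo (cm_space M) (cm_space N)) : cmonIso (state M) (state N).
Proof.
exists (push_fun phi) (push_fun (homeo_sym phi)).
- move=> z; apply: state_eq => f; rewrite /= -pullM_comp.
  rewrite (_ : homeo_comp _ _ = homeo_id _) ?pullM_id //.
  by apply: homeo_eq => x /=; rewrite homeo_funK.
- move=> z; apply: state_eq => f; rewrite /= -pullM_comp.
  rewrite (_ : homeo_comp _ _ = homeo_id _) ?pullM_id //.
  by apply: homeo_eq => x /=; rewrite homeo_invK.
- exact: state_eq.
- by move=> x y; exact: state_eq.
- by move=> I m; exact: state_eq.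
Defined.

Section Action.
Variables (T : topologicalType) (M : cmfd R n T).

Definition homeo_act (phi : Homeog (cm_space M)) : cmonAut (state M) :=
  push phi.

Let act1 : homeo_act 1%g = 1%g.
Proof.
by apply: cmonIso_eq => z; apply: state_eq => f; rewrite /= pullM_id.
Qed.
Let actM : {morph homeo_act : x y / (x * y)%g}.
Proof.
by move=> x y; apply: cmonIso_eq => z; apply: state_eq => f; rewrite /= pullM_comp.
Qed.

HB.instance Definition _ := isMultiplicative.Build _ _ homeo_act actM.
HB.instance Definition _ :=
  Multiplicative_isUMagmaMorphism.Build _ _ homeo_act act1.

End Action.

End StateModule.

(* Main.v *)
Require Import Defs.
From HB Require Import structures.
From mathcomp Require Import all_boot all_order all_algebra.
From mathcomp Require Import all_classical all_reals all_analysis.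

(** If [phi] and [psi] are isotopic, then psi^-1 phi is a self-homeomorphism of
    M isotopic to the identity, and phi = psi (psi^-1 phi).  By functoriality
    of the pullback of fields, phi^* g = (psi^-1 phi)^* (psi^* g) for every
    field g on N, and a state does not distinguish this from psi^* g, its
    invariance under the isotopy class of the identity being part of the
    definition of the state module.  Hence phi_* z and psi_* z agree on every
    g ([push_isotopic]).  The action of the homeomorphism group is thus
    constant on isotopy classes, and such a morphism descends to the quotient
    group ([mcg_factor]). *)

(** Composing an isotopy from [phi] to [psi] with the constant isotopy at the
    inverse of [psi] moves its end point to the identity. *)
Lemma isotopic_divl (R : realType) (X Y : topologicalType)
    (phi psi : homeo X Y) :
  isotopic R phi psi ->
  isotopic R (homeo_comp (homeo_sym psi) phi) (homeo_id X).
Proof.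
move=> iso; have -> : homeo_id X = homeo_comp (homeo_sym psi) psi.
  by apply: homeo_eq => x /=; rewrite homeo_funK.
by apply: isotopic_comp => //; exact: isotopic_refl.
Qed.

Lemma push_isotopic (R : realType) (n : nat) (S : completeSemiRingType)
    (C : strictMonCat) (F : fieldSystem R n) (T T' : topologicalType)
    (M : cmfd R n T) (N : cmfd R n T') (phi psi : homeo (cm_space M) (cm_space N)) :
  isotopic R phi psi -> push S C F phi = push S C F psi.
Proof.
move=> iso; apply: cmonIso_eq => z; apply: state_eq => g /=.
have -> : phi = homeo_comp psi (homeo_comp (homeo_sym psi) phi).
  by apply: homeo_eq => x /=; rewrite homeo_invK.
by rewrite pullM_comp stateP //; exact: isotopic_divl.
Qed.

(** The universal property of the mapping class group as the quotient of the
    homeomorphism group by isotopy.  The induced map is evaluated at a chosen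
    representative, the choice being immaterial because [f] is constant on
    isotopy classes. *)
Lemma mcg_factor (R : realType) (X : topologicalType) (G : groupType)
    (f : UMagmaMorphism.type (Homeog X) G) :
  (forall phi psi : Homeog X, isotopic R phi psi -> f phi = f psi) ->
  exists rho : UMagmaMorphism.type (MCG R X) G,
    forall phi : Homeog X, rho (mcg_class R phi) = f phi.
Proof.
move=> f_isotopic; pose r (a : MCG R X) : G := f (mcg_repr a).
have rE phi : r (mcg_class R phi) = f phi.
  by apply: f_isotopic; apply/mcg_classP; rewrite mcg_reprK.
have r_morph : monoid_morphism r.
  split=> [|a b]; first by rewrite [LHS]rE gmulf1.
  by rewrite [LHS]rE gmulfM.
pose rho := HB.pack_for (UMagmaMorphism.type (MCG R X) G) r
  (isUMagmaMorphism.Build _ _ r r_morph).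
by exists rho.
Qed.

Theorem theorem6p7 (R : realType) (n : nat) (S : completeSemiRingType)
    (C : strictMonCat) (F : fieldSystem R n) :
  (forall (T T' : topologicalType) (M : cmfd R n T) (N : cmfd R n T')
      (phi psi : homeo (cm_space M) (cm_space N)),
    isotopic R phi psi -> push S C F phi = push S C F psi)
  /\
  (forall (T : topologicalType) (M : cmfd R n T),
    exists rho : UMagmaMorphism.type
                   (MCG R (cm_space M)) (cmonAut (state S C F M)),
      forall phi : Homeog (cm_space M),
        rho (mcg_class R phi) = homeo_act S C F phi).
Proof.
split=> [|T M]; first exact: push_isotopic.
by apply: mcg_factor => phi psi; exact: push_isotopic.
Qed.
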